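(* Let $G$ be a locally compact group, $K$ a compact subgroup with normalized Haar measure $dk$, and $\mu:G\to\mathbb{C}\setminus\{0\}$ a continuous character. Let $f,g\in\mathcal{C}(G)$ satisfy $$\int_K f(xkyk^{-1})\,dk+\mu(y)\int_K f(xky^{-1}k^{-1})\,dk=2f(x)g(y)\quad\text{for all } x,y\in G,$$ and assume $C_Kf\neq 0$. Then $g$ satisfies $$\int_K g(xkyk^{-1})\,dk+\mu(y)\int_K g(xky^{-1}k^{-1})\,dk=2g(x)g(y)\quad\text{for all } x,y\in G.$$
   Context: $\mathcal{C}(G)$ is the space of complex continuous functions on $G$. A character of $G$ is a homomorphism $G\to\mathbb{C}\setminus\{0\}$. The operator $C_K$ is $(C_Kf)(x)=\int_K f(kxk^{-1})\,dk$. *)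

(* Defs.v *)
From HB Require Import structures.
From mathcomp Require Import all_boot all_order all_algebra.
From mathcomp Require Import all_classical all_reals all_analysis.
From mathcomp Require Import complex.
Set Implicit Arguments. Unset Strict Implicit. Unset Printing Implicit Defensive.
Import Order.TTheory GRing.Theory Num.Theory.
Import numFieldNormedType.Exports.
Local Open Scope classical_set_scope.
Local Open Scope ring_scope.

(* Topology on the complex numbers R[i]: the usual one, induced by the
   modulus (the generic numField topology, made canonical on R[i]). *)
HB.instance Definition _ (R : rcfType) :=
  PseudoPointedMetric.copy R[i] (R[i])^o.

Record topological_group (G : ptopologicalType) (mul : G -> G -> G)
    (inv : G -> G) (one : G) : Prop := {
  tg_assoc : associative mul;
  tg_mul1 : left_id one mul;
  tg_mulV : left_inverse one inv mul;
  tg_mul_cont : continuous (fun p : G * G => mul p.1 p.2);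
  tg_inv_cont : continuous inv }.

Definition locally_compact_group (G : ptopologicalType) (mul : G -> G -> G)
    (inv : G -> G) (one : G) : Prop :=
  [/\ topological_group mul inv one, hausdorff_space G &
      locally_compact [set: G]].

Definition compact_subgroup (G : ptopologicalType) (mul : G -> G -> G)
    (inv : G -> G) (one : G) (K : set G) : Prop :=
  [/\ K one, (forall x y, K x -> K y -> K (mul x y)),
      (forall x, K x -> K (inv x)) & compact K].

Definition borel (G : ptopologicalType) := g_sigma_algebraType (@open G).

(* mu is the normalized Haar measure of the compact group K, viewed as a
   (regular) Borel probability measure on G concentrated on K, invariant
   under left and right translations by elements of K. *)
Record normalized_haar (R : realType) (G : ptopologicalType)
    (mul : G -> G -> G) (K : set G)
    (mu : {measure set (borel G) -> \bar R}) : Prop := {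
  haar_K : mu K = 1%E;
  haar_supp : mu (~` K) = 0%E;
  haar_left : forall k (A : set (borel G)), K k -> measurable A ->
    A `<=` K -> mu [set mul k a | a in A] = mu A;
  haar_right : forall k (A : set (borel G)), K k -> measurable A ->
    A `<=` K -> mu [set mul a k | a in A] = mu A;
  haar_outer : forall A : set (borel G), measurable A ->
    mu A = ereal_inf [set mu U | U in [set U : set G | open U /\ A `<=` U]];
  haar_inner : forall U : set G, open U ->
    mu U = ereal_sup [set mu C | C in [set C : set G | compact C /\ C `<=` U]] }.

Definition cintegral (R : realType) (G : ptopologicalType)
    (mu : {measure set (borel G) -> \bar R}) (D : set (borel G))
    (f : G -> R[i]) : R[i] :=
  ((Rintegral mu D (fun x => complex.Re (f x)))%:C +
   'i * (Rintegral mu D (fun x => complex.Im (f x)))%:C)%C.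

Definition CK (R : realType) (G : ptopologicalType) (mul : G -> G -> G)
    (inv : G -> G) (K : set G) (mu : {measure set (borel G) -> \bar R})
    (f : G -> R[i]) (x : G) : R[i] :=
  cintegral mu K (fun k => f (mul (mul k x) (inv k))).

(* Main.v *)
(* Let [L y f (x) = int_K f(x k y k^-1) dk] and [L* y = chi(y) L(y^-1)], so that
   the hypothesis reads [(L y + L* y) f = 2 g(y) f].  Averages of products such
   as [L y L z] are again averages of operators [L w], and [*] reverses
   products; hence every self-adjoint combination of products of the [L y]
   acts on [f] as a scalar.  In particular, for [D z = L z + L* z],
   [L y D z + D z L* y] acts on [f] as twice the left-hand side of the
   conclusion at [(y, z)], which rearranges to
   [D z (L y f) - 2 g(z) L y f = c f], where [c] is the scalar that has to
   vanish.  Applying [L* y] to this equation gives [c L* y f = s f], since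
   [L* y D z L y] and [L* y L y] are self-adjoint.  If [c] were nonzero,
   [L* y f], hence also [L y f], would be a multiple of [f], and the equation
   itself would then force [c f = 0]. *)
Require Import Defs.
From HB Require Import structures.
From mathcomp Require Import all_boot all_order all_algebra.
From mathcomp Require Import all_classical all_reals all_analysis.
From mathcomp Require Import complex ring.
Import Order.TTheory GRing.Theory Num.Theory.
Import numFieldNormedType.Exports.
Local Open Scope classical_set_scope.
Local Open Scope ring_scope.

(** * Uniformity over compact sets and real integrals depending on a parameter *)

(** A tube argument: around each [(p, x)] there is a rectangle on which [F] stays within [e / 2] of
    [F p x]. Both [F q y] and [F p y] are compared with that value, and compactness of [K] makes the
    neighbourhood of [p] uniform. *)
Lemma compact_uniform_near (R : realType) (T X : topologicalType) (K : set X)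
    (F : T -> X -> R) (p : T) (e : R) :
  compact K -> continuous (fun q : T * X => F q.1 q.2) -> 0 < e ->
  \forall q \near p, forall k, K k -> `|F q k - F p k| <= e.
Proof.
move=> /compact_near_coveringP cK cF e0.
apply: (cK T (nbhs p) (fun q k => `|F q k - F p k| <= e)) => x Kx.
have e2 : 0 < e / 2 by rewrite divr_gt0.
have /cvgrPdist_lt /(_ _ e2) [[A B] [/= pA xB] sAB] := cF (p, x).
exists (B, A) => //= -[y q] [/= By Aq].
have h1 : `|F p x - F q y| < e / 2 by apply: (sAB (q, y)).
have h2 : `|F p x - F p y| < e / 2.
  by apply: (sAB (p, y)); split => //=; exact: nbhs_singleton.
rewrite (_ : F q y - F p y = (F p x - F p y) - (F p x - F q y)); last first.
  by ring.
rewrite (le_trans (ler_normB _ _))// [leRHS]splitr lerD//; exact: ltW.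
Qed.

Lemma continuous_borel_measurable (R : realType) (G : ptopologicalType)
    (u : G -> R) :
  continuous u -> measurable_fun setT (u : borel G -> R).
Proof.
move=> /continuousP cu.
apply: (measurability _ (measurable_realfun.RGenOpens.measurableE R)).
move=> _ [_ [a [b ->]] <-]; rewrite setTI.
by apply: sub_sigma_algebra; apply: cu; exact: interval_open.
Qed.

(* The exchange of integrals is proved by hand: the Borel sigma-algebra of
   [G * G] may be larger than the product sigma-algebra, so that a continuous
   integrand need not be measurable for the product measure.  By compactness,
   [K] is covered by finitely many Borel pieces on which [F h k] varies by at
   most [e] in [k], uniformly in [h]. *)
Section CompactIntegral.
Context {R : realType} {G : ptopologicalType}.
Variable mu : {measure set (borel G) -> \bar R}.
Variable K : set G.
Hypotheses (cK : compact K) (mK : measurable (K : set (borel G)))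
  (muK : mu K = 1%E).
Implicit Types (D : set (borel G)) (u v : G -> R).

Lemma continuous_integrable D u : measurable D -> D `<=` K ->
  continuous u -> mu.-integrable D (EFin \o u).
Proof.
move=> mD DK cu; apply: (@integrableS _ _ _ mu K) => //.
apply: measurable_bounded_integrable; rewrite ?muK ?ltry//.
- by apply: measurable_funTS; exact: continuous_borel_measurable.
- have /compact_bounded[M [_ mrt]] :=
    continuous_compact (continuous_subspaceT cu) cK.
  exists M; split; rewrite ?num_real // => y My x Kx /=.
  by apply: mrt => //; exists x.
Qed.

Lemma fine_measure_le1 D : measurable D -> D `<=` K ->
  0 <= fine (mu D) <= 1.
Proof.
move=> mD DK; rewrite fine_ge0//= -[leRHS]/(fine 1%E) -muK fine_le //.
- rewrite ge0_fin_numE//; apply: (@le_lt_trans _ _ (mu K)).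
    by rewrite le_measure// inE.
  by rewrite muK ltry.
- by rewrite muK.
- by rewrite le_measure// inE.
Qed.

Lemma Rintegral_dist_le D u v (e : R) : measurable D -> D `<=` K ->
  continuous u -> continuous v -> (forall k, D k -> `|u k - v k| <= e) ->
  `|Rintegral mu D u - Rintegral mu D v| <= e * fine (mu D).
Proof.
move=> mD DK cu cv uv.
have iu := continuous_integrable _ _ mD DK cu.
have iv := continuous_integrable _ _ mD DK cv.
have cuv : continuous (fun x => u x - v x).
  by move=> x; apply: cvgB; [exact: cu|exact: cv].
have iuv := continuous_integrable _ _ mD DK cuv.
have cn : continuous (fun x => `|u x - v x|).
  by move=> x; apply: cvg_norm; exact: cuv.
have ce : continuous (fun _ : G => e) by move=> x; exact: cvg_cst.
rewrite -RintegralB//; apply: (le_trans (le_normr_Rintegral mD iuv)).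
rewrite -Rintegral_cst//; apply: le_Rintegral => //.
- exact: (continuous_integrable _ _ mD DK cn).
- exact: (continuous_integrable _ _ mD DK ce).
Qed.

(** Nearby parameters give integrands uniformly close on [K], and [D] has mass at most 1. *)
Lemma continuous_Rintegral (T : topologicalType) (F : T -> G -> R) D :
  measurable D -> D `<=` K ->
  continuous (fun q : T * G => F q.1 q.2) ->
  continuous (fun p => Rintegral mu D (F p)).
Proof.
move=> mD DK cF p; apply/cvgrPdist_le => e e0.
have cFp q : continuous (F q).
  by move=> x; apply: (@continuous_comp _ _ _ (pair q)) (cF _);
    apply: cvg_pair; [exact: cvg_cst|exact: cvg_id].
have := compact_uniform_near _ _ _ _ F p e cK cF e0.
apply: filterS => q Hq; rewrite distrC.
apply: (le_trans (Rintegral_dist_le D _ _ e mD DK (cFp q) (cFp p) _)).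
  by move=> k /DK; exact: Hq.
by have /andP[_ ?] := fine_measure_le1 D mD DK; rewrite ler_piMr// ltW.
Qed.

(** * Exchange of two integrals over K *)

Section Exchange.
Variable F : G -> G -> R.
Hypothesis cF : continuous (fun q : G * G => F q.1 q.2).

Let cFl h : continuous (F h).
Proof.
move=> x; apply: (@continuous_comp _ _ _ (pair h)) (cF _).
by apply: cvg_pair; [exact: cvg_cst|exact: cvg_id].
Qed.

Let cswap : continuous (fun q : G * G => F q.2 q.1).
Proof.
move=> x; apply: (@continuous_comp _ _ _ (fun q : G * G => (q.2, q.1))) (cF _).
by apply: cvg_pair; [exact: cvg_snd|exact: cvg_fst].
Qed.

Let cFr k : continuous (F^~ k).
Proof.
move=> x; apply: (@continuous_comp _ _ _ (fun h => (h, k))) (cF _).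
by apply: cvg_pair; [exact: cvg_id|exact: cvg_cst].
Qed.

(** In both iterated integrals only [k] is restricted to [D], while [h] ranges over all of [K]. Both
    are therefore additive in [D]. *)
Let J D := Rintegral mu K (fun h => Rintegral mu D (F h)).
Let J' D := Rintegral mu D (fun k => Rintegral mu K (F^~ k)).

(** On a piece where [F h k] is close to [F h a], both iterated integrals are within [e * m] of the
    integral of [F h a] over [h], times the mass [m] of [D]. The bound is written as an integral
    over [D] to make it additive too. *)
Let exchange_small D (a : G) (e : R) : measurable D -> D `<=` K ->
  (forall k, D k -> forall h, K h -> `|F h k - F h a| <= e) ->
  `|J D - J' D| <= Rintegral mu D (fun _ => e *+ 2).
Proof.
move=> mD DK Fe; set m := fine (mu D).
have m1 : Rintegral mu K (fun h => F h a * m) = Rintegral mu K (F^~ a) * m.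
  by apply: RintegralZr => //; apply: continuous_integrable => //; exact: cFr.
have cJ := continuous_Rintegral G F D mD DK cF.
have cJ' :=
  continuous_Rintegral G (fun k h => F h k) K mK (@subset_refl _ K) cswap.
have h1 : `|J D - Rintegral mu K (fun h => F h a * m)| <= e * m.
  rewrite -[leRHS]mulr1 -[1]/(fine 1%E) -muK.
  apply: Rintegral_dist_le => //.
    by move=> x; apply: cvgM; [exact: cFr|exact: cvg_cst].
  move=> h Kh; rewrite -Rintegral_cst//.
  apply: (Rintegral_dist_le D (F h) (fun _ => F h a)) => //.
    exact: cst_continuous.
  by move=> k Dk; exact: Fe.
have h2 : `|J' D - Rintegral mu K (F^~ a) * m| <= e * m.
  rewrite -Rintegral_cst//.
  apply: (Rintegral_dist_le D _ (fun _ => Rintegral mu K (F^~ a))) => //.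
    exact: cst_continuous.
  move=> k Dk; rewrite -[leRHS]mulr1 -[1]/(fine 1%E) -muK.
  apply: (Rintegral_dist_le K (F^~ k) (F^~ a)) => // h Kh.
  exact: Fe.
rewrite Rintegral_cst// -/m mulrnAl mulr2n.
rewrite m1 in h1; rewrite distrC in h2.
by rewrite (le_trans (ler_distD (Rintegral mu K (F^~ a) * m) _ _))// lerD.
Qed.

Let Rintegral_setID D (U : set (borel G)) u : measurable D -> measurable U ->
  D `<=` K -> continuous u ->
  Rintegral mu D u = Rintegral mu (D `&` U) u + Rintegral mu (D `\` U) u.
Proof.
move=> mD mU DK cu; rewrite -{1}(setUIDK D U) Rintegral_setU//.
- exact: measurableI.
- exact: measurableD.
- by rewrite setUIDK; exact: continuous_integrable.
- by apply/disj_setPS => x [[_ Ux] [_]].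
Qed.

(** Induction on the cover: [U a] cuts [D] into a small piece and a rest covered by the tail. Since
    the bound is additive in [D], the errors do not accumulate with the number of pieces. *)
Let exchange_cover (e : R) (U : G -> set G) (s : seq G) D :
  (forall a, open (U a)) ->
  (forall a k, U a k -> forall h, K h -> `|F h k - F h a| <= e) ->
  measurable D -> D `<=` K -> (forall k, D k -> exists2 a, a \in s & U a k) ->
  `|J D - J' D| <= Rintegral mu D (fun _ => e *+ 2).
Proof.
move=> oU Ue; elim: s D => [|a s IH] D mD DK Ds.
  have -> : D = set0 by apply/seteqP; split => // k /Ds[].
  rewrite /J /J' !Rintegral_set0.
  under eq_Rintegral do rewrite Rintegral_set0.
  by rewrite Rintegral_cst// mul0r subrr normr0.
have mU : measurable (U a : set (borel G)) by exact: sub_sigma_algebra.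
have mI : measurable (D `&` U a : set (borel G)) by exact: measurableI.
have mDU : measurable (D `\` U a : set (borel G)) by exact: measurableD.
have IK : D `&` U a `<=` K by move=> k [/DK].
have DUK : D `\` U a `<=` K by move=> k [/DK].
have -> : J D = J (D `&` U a) + J (D `\` U a).
  rewrite /J -RintegralD//; first last.
  - by apply: continuous_integrable => //; exact: continuous_Rintegral.
  - by apply: continuous_integrable => //; exact: continuous_Rintegral.
  by apply: eq_Rintegral => h _; exact: Rintegral_setID.
have -> : J' D = J' (D `&` U a) + J' (D `\` U a).
  apply: Rintegral_setID => //.
  exact: (continuous_Rintegral G (fun k h => F h k)).
rewrite (Rintegral_setID D (U a) (fun _ => e *+ 2))//; last first.
  exact: cst_continuous.
rewrite opprD addrACA (le_trans (ler_normD _ _))//.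
rewrite lerD//.
  by apply: (exchange_small _ a) => // k [_ /Ue].
apply: IH => // k [Dk nUk]; have [b] := Ds k Dk.
by rewrite inE => /predU1P[->//|bs Ubk]; exists b.
Qed.

Lemma Rintegral_exchange :
  Rintegral mu K (fun h => Rintegral mu K (F h)) =
  Rintegral mu K (fun k => Rintegral mu K (F^~ k)).
Proof.
apply/eqP; rewrite -subr_eq0 -normr_le0.
apply/ler_addgt0Pl => e e0; rewrite addr0.
have e2 : 0 < e / 2 by rewrite divr_gt0.
(* The tolerance [e / 2] compensates the factor 2 in the bound of [exchange_cover]; interiors of the
   [W a] will form the open cover. *)
pose W a := [set k | forall h, K h -> `|F h k - F h a| <= e / 2].
have Wa a : nbhs a (W a).
  exact: (compact_uniform_near _ _ _ K (fun k h => F h k)).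
move: (cK); rewrite compact_cover => /(_ G setT (fun a => (W a)^°)) [].
- by move=> a _; exact: open_interior.
- by move=> a _; exists a => //; exact: Wa.
move=> s _ Ks.
have := exchange_cover (e / 2) (fun a => (W a)^°) (finmap.enum_fset s) K.
have e2E : e / 2 *+ 2 = e by rewrite [RHS]splitr.
rewrite (Rintegral_cst mu mK (e / 2 *+ 2)) muK mulr1 e2E; apply => //.
- by move=> a; exact: open_interior.
- by move=> a k /interior_subset; exact.
Qed.
End Exchange.
End CompactIntegral.

(** * Complex-valued continuous functions and their integrals *)

(** Continuity is split into components because [cintegral] is defined by real and imaginary
    parts. *)
Definition ccontinuous {R : realType} {T : topologicalType} (u : T -> R[i]) :=
  continuous (fun x => complex.Re (u x)) /\
  continuous (fun x => complex.Im (u x)).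

Lemma continuous_ccontinuous (R : realType) (T : topologicalType)
    (u : T -> R[i]) : continuous u -> ccontinuous u.
Proof.
have ReIm (z : R[i]) (e : R) : `|z| < e%:C%C ->
    `|complex.Re z| < e /\ `|complex.Im z| < e.
  move=> ze; split.
    by rewrite -ltcR (le_lt_trans _ ze)// normc_ge_Re.
  rewrite -ltcR (le_lt_trans _ ze)//.
  case: z {ze} => a b /=; rewrite normc_def lecR/= -sqrtr_sqr.
  by rewrite ler_sqrt ?lerDr ?addr_ge0 ?sqr_ge0.
move=> cu.
have near_dist x (e : R) : 0 < e -> \forall t \near x, `|u x - u t| < e%:C%C.
  move=> e0; have e0C : 0 < e%:C%C :> R[i] by rewrite ltcR.
  have := cu x _ (@nbhsx_ballx _ (R[i]^o) (u x) (e%:C%C) e0C).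
  by rewrite nbhs_filterE fmapE; apply: filterS => t; rewrite /ball/=.
split => x; apply/cvgrPdist_lt => e /(near_dist x);
  apply: filterS => t /ReIm; rewrite !raddfB => -[] //.
Qed.

Lemma ccontinuous_comp (R : realType) (S T : topologicalType)
    (a : S -> T) (u : T -> R[i]) :
  continuous a -> ccontinuous u -> ccontinuous (u \o a).
Proof.
move=> ca [cr ci]; split=> x.
  exact: (@continuous_comp _ _ _ a _ x (ca x) (cr (a x))).
exact: (@continuous_comp _ _ _ a _ x (ca x) (ci (a x))).
Qed.

Lemma ReM (R : realType) (a b : R[i]) : complex.Re (a * b) =
  complex.Re a * complex.Re b - complex.Im a * complex.Im b.
Proof. by case: a b => [? ?] [? ?]. Qed.

Lemma ImM (R : realType) (a b : R[i]) : complex.Im (a * b) =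
  complex.Re a * complex.Im b + complex.Im a * complex.Re b.
Proof. by case: a b => [? ?] [? ?]. Qed.

Lemma ccontinuousZ (R : realType) (T : topologicalType) (c : R[i])
  (u : T -> R[i]) : ccontinuous u -> ccontinuous (fun x => c * u x).
Proof.
move=> [ur ui]; split=> x.
  under eq_fun do rewrite ReM.
  by apply: cvgB; apply: cvgM;
    [exact: cvg_cst|exact: ur|exact: cvg_cst|exact: ui].
under eq_fun do rewrite ImM.
by apply: cvgD; apply: cvgM;
  [exact: cvg_cst|exact: ui|exact: cvg_cst|exact: ur].
Qed.

Section ComplexIntegral.
Context {R : realType} {G : ptopologicalType}.
Variable mu : {measure set (borel G) -> \bar R}.
Variable K : set G.
Hypotheses (cK : compact K) (mK : measurable (K : set (borel G)))
  (muK : mu K = 1%E).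
Implicit Types u v : G -> R[i].

Lemma cintegralE u : cintegral mu K u =
  (Rintegral mu K (fun x => complex.Re (u x)) +i*
   Rintegral mu K (fun x => complex.Im (u x)))%C.
Proof. by rewrite [RHS]complexE. Qed.

Let integ (w : G -> R) : continuous w -> mu.-integrable K (EFin \o w).
Proof. by move=> cw; exact: (continuous_integrable mu K cK mK muK). Qed.

Lemma eq_cintegral u v : (forall k, K k -> u k = v k) ->
  cintegral mu K u = cintegral mu K v.
Proof.
move=> uv; rewrite !cintegralE; congr (_ +i* _)%C;
  by apply: eq_Rintegral => k; rewrite inE => /uv ->.
Qed.

Lemma cintegralD u v : ccontinuous u -> ccontinuous v ->
  cintegral mu K (fun k => u k + v k) = cintegral mu K u + cintegral mu K v.
Proof.
move=> [/integ ur /integ ui] [/integ vr /integ vi]; rewrite !cintegralE.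
by congr (_ +i* _)%C; rewrite -RintegralD//;
  apply: eq_Rintegral => k _; rewrite raddfD.
Qed.

Lemma cintegralZ c u : ccontinuous u ->
  cintegral mu K (fun k => c * u k) = c * cintegral mu K u.
Proof.
move=> [ur ui].
have cZ (a : R) (w : G -> R) : continuous w -> continuous (fun k => a * w k).
  by move=> cw x; apply: cvgM; [exact: cvg_cst|exact: cw].
rewrite !cintegralE; apply/eqP; rewrite eq_complex ReM ImM /=.
rewrite -!RintegralZl//; try exact: integ.
rewrite -RintegralB//; try by apply: integ; exact: cZ.
rewrite -RintegralD//; try by apply: integ; exact: cZ.
by apply/andP; split; apply/eqP; apply: eq_Rintegral => k _; rewrite ?ReM ?ImM.
Qed.

Lemma ccontinuous_cintegral (T : topologicalType) (F : T -> G -> R[i]) :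
  ccontinuous (fun q : T * G => F q.1 q.2) ->
  ccontinuous (fun p => cintegral mu K (F p)).
Proof.
move=> [cr ci]; split.
  under eq_fun do rewrite cintegralE /=.
  exact: (continuous_Rintegral mu K cK mK muK T
    (fun p k => complex.Re (F p k))).
under eq_fun do rewrite cintegralE /=.
exact: (continuous_Rintegral mu K cK mK muK T
    (fun p k => complex.Im (F p k))).
Qed.

Lemma cintegral_exchange (F : G -> G -> R[i]) :
  ccontinuous (fun q : G * G => F q.1 q.2) ->
  cintegral mu K (fun h => cintegral mu K (F h)) =
  cintegral mu K (fun k => cintegral mu K (F^~ k)).
Proof.
move=> [cr ci]; rewrite [LHS]cintegralE [RHS]cintegralE.
apply: (f_equal2 (@Complex R)).
  under eq_Rintegral do rewrite cintegralE /=.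
  under [RHS]eq_Rintegral do rewrite cintegralE /=.
  exact: (Rintegral_exchange mu K cK mK muK (fun p k => complex.Re (F p k))).
under eq_Rintegral do rewrite cintegralE /=.
under [RHS]eq_Rintegral do rewrite cintegralE /=.
exact: (Rintegral_exchange mu K cK mK muK (fun p k => complex.Im (F p k))).
Qed.
End ComplexIntegral.

(** * Group identities, conjugation and continuity of the group operations *)

Lemma fst_continuous (S T U : topologicalType) (a : S -> T * U) :
  continuous a -> continuous (fun s => (a s).1).
Proof. by move=> ca s; apply: continuous_comp (ca s) _; exact: cvg_fst. Qed.

Lemma snd_continuous (S T U : topologicalType) (a : S -> T * U) :
  continuous a -> continuous (fun s => (a s).2).
Proof. by move=> ca s; apply: continuous_comp (ca s) _; exact: cvg_snd. Qed.

Section Group.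
Context {G : ptopologicalType} {mul : G -> G -> G} {inv : G -> G} {one : G}.
Hypothesis tgG : topological_group mul inv one.

Let mulA := tg_assoc tgG.
Let mul1 := tg_mul1 tgG.
Let mulV := tg_mulV tgG.

(** The group axioms are left-sided; the right-sided law follows by multiplying on the left by
    [inv (inv x)] times [inv x]. *)
Lemma tg_mulrV x : mul x (inv x) = one.
Proof.
rewrite -[LHS]mul1 -{1}(mulV (inv x)) -mulA [mul (inv x) _]mulA mulV mul1.
exact: mulV.
Qed.

Lemma tg_mulr1 x : mul x one = x.
Proof. by rewrite -(mulV x) mulA tg_mulrV mul1. Qed.

Lemma tg_inv_uniq x y : mul x y = one -> y = inv x.
Proof. by move=> xy; rewrite -[LHS]mul1 -(mulV x) -mulA xy tg_mulr1. Qed.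

Lemma tg_invK x : inv (inv x) = x.
Proof. by rewrite -(tg_inv_uniq (inv x) x). Qed.

Lemma tg_invM x y : inv (mul x y) = mul (inv y) (inv x).
Proof.
rewrite -(tg_inv_uniq (mul x y) (mul (inv y) (inv x)))//.
by rewrite -mulA [mul y _]mulA tg_mulrV mul1 tg_mulrV.
Qed.

Lemma tg_mul_continuous (T : topologicalType) (a b : T -> G) :
  continuous a -> continuous b -> continuous (fun t => mul (a t) (b t)).
Proof.
move=> ca cb t.
apply: (@continuous_comp _ _ _ (fun t => (a t, b t)) (fun p => mul p.1 p.2)).
  by apply: cvg_pair; [exact: ca|exact: cb].
exact: (tg_mul_cont tgG).
Qed.

Lemma tg_inv_continuous (T : topologicalType) (a : T -> G) :
  continuous a -> continuous (fun t => inv (a t)).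
Proof.
move=> ca t; apply: (@continuous_comp _ _ _ a inv); first exact: ca.
exact: (tg_inv_cont tgG).
Qed.

Definition conjby k y := mul (mul k y) (inv k).

Lemma conj_continuous (T : topologicalType) (a b : T -> G) :
  continuous a -> continuous b -> continuous (fun t => conjby (a t) (b t)).
Proof.
move=> ca cb; apply: tg_mul_continuous; last exact: tg_inv_continuous.
exact: tg_mul_continuous.
Qed.

Lemma conjM k x y : conjby k (mul x y) = mul (conjby k x) (conjby k y).
Proof.
rewrite /conjby -!mulA; congr (mul k (mul x _)).
by rewrite [RHS]mulA mulV mul1.
Qed.

Lemma conj_conj h k y : conjby (mul h k) y = conjby h (conjby k y).
Proof. by rewrite /conjby tg_invM !mulA. Qed.

Lemma conjV k y : conjby k (inv y) = inv (conjby k y).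
Proof. by rewrite /conjby !tg_invM tg_invK mulA. Qed.

(** * Invariance of integrals over K under left translation *)

Section Haar.
Context {R : realType}.
Variable K : set G.
Variable mu : {measure set (borel G) -> \bar R}.
Hypotheses (mK : measurable (K : set (borel G)))
  (KG : compact_subgroup mul inv one K)
  (muK : normalized_haar mul K mu).

(** Change of variables along [mul h]: the preimage of a Borel set [A] inside [K] is its translate
    by [inv h], so left invariance makes the pushforward of [mu] agree with [mu] on [K]. *)
Lemma Rintegral_translate h (u : G -> R) : K h -> continuous u ->
  Rintegral mu K (fun k => u (mul h k)) = Rintegral mu K u.
Proof.
move=> Kh cu; case: KG => _ KM KV cK.
have cmul : continuous (mul h).
  by apply: tg_mul_continuous; [exact: cst_continuous|exact: (fun x => cvg_id)].
have mmul : measurable_fun setT (mul h : borel G -> borel G).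
  apply: (@measurability _ _ (borel G) (borel G) setT (mul h) (@open G) erefl).
  move=> _ [U oU <-]; rewrite setTI; apply: sub_sigma_algebra.
  by move/continuousP : cmul; apply.
have preK : mul h @^-1` K = K.
  apply/seteqP; split=> k /=; last exact: KM.
  by move=> /(KM _ _ (KV _ Kh)); rewrite mulA mulV mul1.
have cuh : continuous (u \o mul h).
  by move=> x; apply: continuous_comp; [exact: cmul|exact: cu].
rewrite /Rintegral; congr fine; rewrite -[in LHS]preK.
rewrite -(@integral_pushforward _ _ _ _ _ _ mmul mu K (EFin \o u))//;
  last 2 first.
- apply/measurable_realfun.measurable_EFinP.
  exact: continuous_borel_measurable.
- rewrite preK.
  exact: (continuous_integrable mu K cK mK (haar_K muK) _ (u \o mul h)).
apply: eq_measure_integral => A mA AK.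
rewrite /pushforward -(haar_left muK (KV _ Kh) mA AK).
congr (mu _); apply/seteqP; split=> k /=.
  by move=> Ahk; exists (mul h k) => //; rewrite mulA mulV mul1.
by move=> [a Aa <-]; rewrite mulA tg_mulrV mul1.
Qed.

Lemma cintegral_translate h (u : G -> R[i]) : K h -> ccontinuous u ->
  cintegral mu K (fun k => u (mul h k)) = cintegral mu K u.
Proof.
move=> Kh [ur ui]; rewrite !cintegralE; congr (_ +i* _)%C.
  exact: (Rintegral_translate h (fun k => complex.Re (u k))).
exact: (Rintegral_translate h (fun k => complex.Im (u k))).
Qed.

Let cK : compact K. Proof. by case: KG. Qed.
Let mu1 := haar_K muK.

(** * The averaging operators and their products *)

Ltac cont := repeat first
  [ exact: cst_continuous | exact: (fun x => cvg_id)
  | apply: fst_continuous | apply: snd_continuous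
  | apply: tg_mul_continuous | apply: conj_continuous
  | apply: tg_inv_continuous ].

(** This is the operator [L y]; with [f] before [x], the product of operators is plain composition
    [L y (L z f)]. *)
Definition conj_avg y (f : G -> R[i]) x :=
  cintegral mu K (fun k => f (mul x (conjby k y))).
Local Notation L := conj_avg.

Lemma conj_avg_ccontinuous (T : topologicalType) (a b : T -> G) f :
  ccontinuous f -> continuous a -> continuous b ->
  ccontinuous (fun t => L (a t) f (b t)).
Proof.
move=> cf ca cb.
apply: (ccontinuous_cintegral mu K cK mK mu1 T
  (fun t k => f (mul (b t) (conjby k (a t))))).
apply: (ccontinuous_comp _ _ _
  (fun q : T * G => mul (b q.1) (conjby q.2 (a q.1))) f) => //.
have cfst (c : T -> G) : continuous c -> continuous (fun q : T * G => c q.1).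
  by move=> cc x; apply: continuous_comp (cc _); exact: cvg_fst.
by cont; exact: cfst.
Qed.

(** In the double integral of f(x h y h^-1 k z k^-1), the substitution of h k for k turns the
    argument into x h (y k z k^-1) h^-1; the integrals are then exchanged. *)
Lemma conj_avg_mulr y z f x : ccontinuous f ->
  L y (L z f) x = cintegral mu K (fun k => L (mul y (conjby k z)) f x).
Proof.
move=> cf.
rewrite -(cintegral_exchange mu K cK mK mu1
  (fun h k => f (mul x (conjby h (mul y (conjby k z)))))).
  apply: eq_cintegral => h Kh.
  rewrite /conj_avg -(cintegral_translate h) //.
    by apply: eq_cintegral => k _; rewrite conjM conj_conj mulA.
  by apply: (ccontinuous_comp _ _ _
    (fun k => mul (mul x (conjby h y)) (conjby k z)) f) => //; cont.
by apply: (ccontinuous_comp _ _ _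
  (fun q : G * G => mul x (conjby q.1 (mul y (conjby q.2 z)))) f) => //; cont.
Qed.

(** The mirror form, substituting k h for h. At [inv z], [inv y] it averages over the inverses of
    the elements that [conj_avg_mulr] produces at [y], [z], so the two forms pair up in the
    hypothesis. *)
Lemma conj_avg_mull y z f x : ccontinuous f ->
  L y (L z f) x = cintegral mu K (fun k => L (mul (conjby k y) z) f x).
Proof.
move=> cf.
rewrite [LHS](cintegral_exchange mu K cK mK mu1
  (fun h k => f (mul (mul x (conjby h y)) (conjby k z)))); last first.
  by apply: (ccontinuous_comp _ _ _
    (fun q : G * G => mul (mul x (conjby q.1 y)) (conjby q.2 z)) f) => //; cont.
rewrite -(cintegral_exchange mu K cK mK mu1
  (fun k h => f (mul x (conjby k (mul (conjby h y) z))))); last first.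
  by apply: (ccontinuous_comp _ _ _
    (fun q : G * G => mul x (conjby q.1 (mul (conjby q.2 y) z))) f) => //; cont.
apply: eq_cintegral => k Kk.
rewrite -(cintegral_translate k) //.
  by apply: eq_cintegral => h _; rewrite conjM conj_conj mulA.
by apply: (ccontinuous_comp _ _ _
  (fun h => mul (mul x (conjby h y)) (conjby k z)) f) => //; cont.
Qed.

Lemma conj_avg_lin y a b u v x : ccontinuous u -> ccontinuous v ->
  L y (fun t => a * u t + b * v t) x = a * L y u x + b * L y v x.
Proof.
move=> cu cv.
have cc w : ccontinuous w -> ccontinuous (fun k => w (mul x (conjby k y))).
  move=> cw; apply: (ccontinuous_comp _ _ _
    (fun k => mul x (conjby k y)) w) => //; cont.
rewrite /conj_avg cintegralD//; try by apply: ccontinuousZ; exact: cc.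
by rewrite !cintegralZ//; exact: cc.
Qed.

Lemma conj_avg_scale y a u x : ccontinuous u ->
  L y (fun t => a * u t) x = a * L y u x.
Proof.
move=> cu; have := conj_avg_lin y a 0 u u x cu cu.
rewrite mul0r addr0 => <-; congr (L y _ x).
by apply/funext => t; rewrite mul0r addr0.
Qed.

(** * Self-adjoint combinations of averaging operators acting on f *)

Section Wilson.
Variables (chi f g : G -> R[i]).
Hypotheses (chiM : forall x y, chi (mul x y) = chi x * chi y)
  (chi_neq0 : forall x, chi x != 0).
Hypotheses (cf : ccontinuous f) (cg : ccontinuous g).
Hypothesis wilson : forall x y,
  L y f x + chi y * L (inv y) f x = 2 * f x * g y.

Let chi1 : chi one = 1.
Proof. by apply: (mulfI (chi_neq0 one)); rewrite -chiM mul1 mulr1. Qed.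

Let chiV x : chi x * chi (inv x) = 1.
Proof. by rewrite -chiM tg_mulrV. Qed.

Let chi_conj k x : chi (conjby k x) = chi x.
Proof. by rewrite /conjby !chiM mulrAC chiV mul1r. Qed.

Let cL y u : ccontinuous u -> ccontinuous (L y u).
Proof.
by move=> cu; apply: (conj_avg_ccontinuous _ (fun _ => y) id) => //; cont.
Qed.

(* The left-hand side averages the hypothesis at [y (k z k^-1)] over [k]. *)
Lemma wilson2 y z x :
  L y (L z f) x + chi (mul y z) * L (inv z) (L (inv y) f) x
  = 2 * f x * L z g y.
Proof.
rewrite conj_avg_mulr// conj_avg_mull//.
rewrite -cintegralZ//; last by apply: conj_avg_ccontinuous => //; cont.
rewrite -cintegralD//; last 2 first.
- by apply: conj_avg_ccontinuous => //; cont.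
- by apply: ccontinuousZ; apply: conj_avg_ccontinuous => //; cont.
rewrite -cintegralZ//; last first.
  by apply: (ccontinuous_comp _ _ _
    (fun k => mul y (conjby k z)) g) => //; cont.
apply: eq_cintegral => k _.
by rewrite -wilson tg_invM conjV (chiM y (conjby k z)) chi_conj -chiM.
Qed.

(** The product of [L b] and [L c] is an average of operators [L w] with w = b k c k^-1, and
    [wilson2] at [a], [w] is averaged over [k]. *)
Lemma wilson3 a b c x :
  L a (L b (L c f)) x
    + chi (mul a (mul b c)) * L (inv c) (L (inv b) (L (inv a) f)) x
  = f x * (2 * cintegral mu K (fun k => L (mul b (conjby k c)) g a)).
Proof.
have -> : L a (L b (L c f)) x =
    cintegral mu K (fun k => L a (L (mul b (conjby k c)) f) x).
  rewrite -[RHS](cintegral_exchange mu K cK mK mu1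
    (fun h k => L (mul b (conjby k c)) f (mul x (conjby h a)))).
    by apply: eq_cintegral => h _; exact: conj_avg_mulr.
  by apply: conj_avg_ccontinuous => //; cont.
rewrite [in X in _ + X]conj_avg_mull; last exact: cL.
have cl : ccontinuous (fun k => L a (L (mul b (conjby k c)) f) x).
  apply: (ccontinuous_cintegral mu K cK mK mu1 G
    (fun k h => L (mul b (conjby k c)) f (mul x (conjby h a)))).
  by apply: conj_avg_ccontinuous => //; cont.
have cr :
    ccontinuous (fun k => L (mul (conjby k (inv c)) (inv b)) (L (inv a) f) x).
  by apply: conj_avg_ccontinuous; [exact: cL|cont|cont].
rewrite -(cintegralZ mu K cK mK mu1 _ _ cr).
rewrite -(cintegralD mu K cK mK mu1 _ _ cl (ccontinuousZ _ _ _ _ cr)).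
have cl' : ccontinuous (fun k => L (mul b (conjby k c)) g a).
  by apply: conj_avg_ccontinuous => //; cont.
rewrite mulrA [f x * 2]mulrC -cintegralZ//; apply: eq_cintegral => k _.
rewrite -wilson2 tg_invM conjV (chiM a (mul b (conjby k c))).
by rewrite (chiM b (conjby k c)) chi_conj -!chiM.
Qed.

(* [ring] compares atoms up to conversion, which would unfold the integrals. *)
Ltac ring_abs := repeat match goal with
  | |- context [conj_avg ?a ?u ?b] => generalize (conj_avg a u b)
  | |- context [cintegral mu K ?u] => generalize (cintegral mu K u)
  | |- context [chi ?a] => generalize (chi a)
  | |- context [f ?a] => generalize (f a)
  | |- context [g ?a] => generalize (g a)
  end; intros; ring.

Lemma wilson_dalembert x0 y z : f x0 != 0 ->
  L z g y + chi z * L (inv z) g y = 2 * g y * g z.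
Proof.
move=> fx0; set W := LHS.
(* The scalar by which [f] is multiplied in [commE]; it vanishes exactly when the claim holds. *)
pose c := 4 * g y * g z - 2 * W.
suff : c = 0.
  move/eqP; rewrite subr_eq0 => /eqP c0.
  by apply: (@mulfI _ (2 : R[i])); [rewrite pnatr_eq0|rewrite -c0; ring_abs].
have Lwilson u x : L u (fun t => 2 * f t * g z) x = 2 * g z * L u f x.
  rewrite -conj_avg_scale//; congr (L u _ x); apply/funext => t; ring_abs.
have psiE x : L (inv y) f x = (chi (inv y)) * (2 * g y * f x - L y f x).
  have -> : 2 * g y * f x - L y f x = chi y * L (inv y) f x.
    by rewrite [2 * _ * _]mulrAC -wilson addrAC subrr add0r.
  by rewrite mulrA [chi (inv y) * _]mulrC chiV mul1r.
(* Applying [L u] to [psiE] trades [L (inv y) f] for [f] and [L y f] under a further operator. *)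
have Lpsi u x : chi y * L u (L (inv y) f) x =
    2 * g y * L u f x - L u (L y f) x.
  have -> : L (inv y) f = (fun t => (chi (inv y) * (2 * g y)) * f t
      + (- chi (inv y)) * L y f t).
    by apply/funext => t; rewrite psiE; ring_abs.
  rewrite conj_avg_lin//; last exact: cL.
  rewrite mulrDr !mulrA mulrN chiV; ring_abs.
(* With D z = L z + L* z, the hypothesis gives 2 g(z) L y f = L y (D z f), which [wilson2] turns
   into 2 W f - D z (L* y f). Replacing L* y f by 2 g(y) f - L y f yields the equation. *)
have commE x : L z (L y f) x + chi z * L (inv z) (L y f) x
    = 2 * g z * L y f x + c * f x.
  have eP : L y (L z f) x =
      2 * f x * L z g y - chi y * chi z * L (inv z) (L (inv y) f) x.
    by rewrite -wilson2 chiM; ring_abs.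
  have eQ : L y (L (inv z) f) x =
      2 * f x * L (inv z) g y - chi y * chi (inv z) * L z (L (inv y) f) x.
    by rewrite -wilson2 chiM tg_invK; ring_abs.
  have eX : 2 * g z * L y f x = 1 * L y (L z f) x + chi z * L y (L (inv z) f) x.
    rewrite -Lwilson -conj_avg_lin; try exact: cL.
    by congr (L y _ x); apply/funext => t; rewrite mul1r wilson.
  have eA : L z (L y f) x = 2 * g y * L z f x - chi y * L z (L (inv y) f) x.
    by rewrite Lpsi; ring_abs.
  have eB : L (inv z) (L y f) x =
      2 * g y * L (inv z) f x - chi y * L (inv z) (L (inv y) f) x.
    by rewrite Lpsi; ring_abs.
  have eF : L z f x = 2 * f x * g z - chi z * L (inv z) f x.
    by rewrite -wilson; ring_abs.
  rewrite eX eP eQ eA eB eF /c /W; apply/eqP; rewrite -subr_eq0; apply/eqP.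
  (* What remains comes from [eQ], whose factor [chi (inv z)] is multiplied by [chi z]. *)
  transitivity ((chi z * chi (inv z) - 1) * (chi y * L z (L (inv y) f) x)).
    by ring_abs.
  by rewrite chiV subrr mul0r.
apply/eqP/negPn/negP => c_neq0.
(* The first term is the scalar by which [L (inv y)] D z [L y] acts on [f], by [wilson3]. The second
   is 2 g(z) times that of [L (inv y)] [L y], by [wilson2], where both summands coincide. *)
pose s := 2 * cintegral mu K (fun k => L (mul z (conjby k y)) g (inv y))
  - 2 * g z * L y g (inv y).
have psi_f x : c * L (inv y) f x = s * f x.
  have := congr1 (fun u => L (inv y) u x) (funext commE).
  have -> : (fun t => L z (L y f) t + chi z * L (inv z) (L y f) t) =
      (fun t => 1 * L z (L y f) t + chi z * L (inv z) (L y f) t).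
    by apply/funext => t; rewrite mul1r.
  rewrite /= !conj_avg_lin//; try by do 2?exact: cL; apply: cL; exact: cL.
  move=> lc.
  have t2 := wilson2 (inv y) y x; have t3 := wilson3 (inv y) z y x.
  rewrite mulV chi1 tg_invK in t2.
  rewrite !(chiM _ (mul _ _)) chiM mulrCA [chi (inv y) * _]mulrC in t3.
  rewrite chiV mulr1 tg_invK in t3.
  (* The doubled term [A + 1 * A] has the shape of the left-hand side of [t2]. *)
  transitivity (L (inv y) (L z (L y f)) x
      + chi z * L (inv y) (L (inv z) (L y f)) x
      - g z * (L (inv y) (L y f) x + 1 * L (inv y) (L y f) x)).
    transitivity (2 * g z * L (inv y) (L y f) x + c * L (inv y) f x
      - 2 * g z * L (inv y) (L y f) x); first by ring_abs.
    by rewrite -lc; ring_abs.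
  by rewrite [X in X - _]t3 [X in _ - _ * X]t2 /s; ring_abs.
(* The eigenvalue of [L y] on [f], from L y f = 2 g(y) f - L* y f with [L (inv y) f] equal to
   [s / c] times [f]. *)
pose q := 2 * g y - chi y * (s / c).
have phiE : L y f = (fun t => q * f t).
  apply/funext => t; rewrite /q mulrBl [2 * g y * f t]mulrAC -wilson.
  have -> : L (inv y) f t = s / c * f t.
    by apply: (mulfI c_neq0); rewrite psi_f mulrA [c * _]mulrC divfK.
  by ring_abs.
(* Now [commE] reads q D z f = 2 g(z) q f + c f, whereas D z f = 2 g(z) f; hence c f = 0 at [x0]. *)
have := commE x0; rewrite phiE !conj_avg_scale// => hq.
have : c * f x0 = 0.
  transitivity (q * (L z f x0 + chi z * L (inv z) f x0) - 2 * g z * (q * f x0)).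
    rewrite mulrDr [q * (chi z * _)]mulrCA hq; ring_abs.
  by rewrite wilson; ring_abs.
by move/eqP; rewrite mulf_eq0 (negPf c_neq0) (negPf fx0).
Qed.
End Wilson.
End Haar.
End Group.

(** * Deduction of the theorem from the operator identity *)

Theorem theorem2p3 (R : realType) (G : ptopologicalType)
    (mul : G -> G -> G) (inv : G -> G) (one : G) (K : set G)
    (mu : {measure set (borel G) -> \bar R})
    (chi : G -> R[i]) (f g : G -> R[i]) :
  locally_compact_group mul inv one ->
  compact_subgroup mul inv one K ->
  normalized_haar mul K mu ->
  (forall x y, chi (mul x y) = chi x * chi y) ->
  (forall x, chi x != 0) ->
  continuous chi ->
  continuous f -> continuous g ->
  (forall x y,
     cintegral mu K (fun k => f (mul x (mul (mul k y) (inv k))))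
     + chi y * cintegral mu K (fun k => f (mul x (mul (mul k (inv y)) (inv k))))
     = 2 * f x * g y) ->
  CK mul inv K mu f <> (fun _ => 0) ->
  forall x y,
     cintegral mu K (fun k => g (mul x (mul (mul k y) (inv k))))
     + chi y * cintegral mu K (fun k => g (mul x (mul (mul k (inv y)) (inv k))))
     = 2 * g x * g y.
Proof.
move=> [tg hG _] KG muK chiM chi0 _ cf cg wilson CKf x y.
have [_ _ _ cK] := KG.
have mK : measurable (K : set (borel G)).
  (* A compact set in a Hausdorff space is closed, hence Borel. *)
  rewrite -[K]setCK; apply: measurableC; apply: sub_sigma_algebra.
  by apply: closed_openC; exact: compact_closed.
(* If [f] vanished identically, so would its average [CK]. *)
have [x0 fx0] : exists x0, f x0 != 0.
  apply: contrapT => f0; apply: CKf; apply/funext => t; rewrite /CK cintegralE.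
  have -> : f = (fun=> 0).
    by apply/funext => u; apply/eqP/negPn/negP => fu; apply: f0; exists u.
  by rewrite /= !Rintegral_cst// !mul0r.
exact: (wilson_dalembert tg K mu mK KG muK chi f g chiM chi0
  (continuous_ccontinuous _ _ _ cf) (continuous_ccontinuous _ _ _ cg)
  wilson x0).
Qed.
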